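(* The matrices $R,L,A^*$ satisfy the following relations: $$RA^*=qA^*R,\qquad LA^*=q^{-1}A^*L,$$ $$L^2R-q(q+1)LRL+q^3RL^2=-q^{N+M}(q+1)L,$$ $$LR^2-q(q+1)RLR+q^3R^2L=-q^{N+M}(q+1)R.$$
   Context: Let $\mathbb F_q$ be a finite field with $q$ elements, let $N,M$ be positive integers, let $H$ be a vector space over $\mathbb F_q$ of dimension $N+M$, and fix a subspace $h\subseteq H$ of dimension $M$. Let $X$ be the set of subspaces $y\subseteq H$ with $y\cap h=0$, partially ordered by inclusion (the Attenuated Space poset $\mathcal A_q(N,M)$). For $y,z\in X$, $z$ covers $y$ when $y\subseteq z$ and $\dim z-\dim y=1$. Let $\mathrm{Mat}_X(\mathbb C)$ be the algebra of complex matrices with rows and columns indexed by $X$. The raising matrix $R\in\mathrm{Mat}_X(\mathbb C)$ has $(y,z)$-entry $1$ if $y$ covers $z$, and $0$ otherwise. The $q$-lowering matrix $L\in\mathrm{Mat}_X(\mathbb C)$ has $(y,z)$-entry $q^{\dim y}$ if $z$ covers $y$, and $0$ otherwise. The matrix $A^*\in\mathrm{Mat}_X(\mathbb C)$ is diagonal with $(y,y)$-entry $q^{-\dim y}$ for $y\in X$. *)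

(* Defs.v *)
From HB Require Import structures.
From mathcomp Require Import all_boot all_order all_algebra.
From mathcomp Require Import reals.
From mathcomp Require Export complex.
Set Implicit Arguments.
Unset Strict Implicit.
Unset Printing Implicit Defensive.
Import Order.TTheory GRing.Theory Num.Theory.
Local Open Scope ring_scope.

(* Makes the subType structure of {vspace H}, with val := vs2mx, available. *)
Import VectorInternalTheory.

(* Subspaces of a finite-dimensional space over a finite field form a finite
   type, since {vspace H} is a subtype of a type of matrices over F. *)
HB.instance Definition _ (F : finFieldType) (H : vectType F) :=
  [Countable of {vspace H} by <:].
HB.instance Definition _ (F : finFieldType) (H : vectType F) :=
  [Finite of {vspace H} by <:].

Section AttenuatedSpace.
Variables (F : finFieldType) (H : vectType F) (h : {vspace H}).

Definition attenuated := {y : {vspace H} | (y :&: h == 0)%VS}.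

Definition sdim (y : attenuated) : nat := \dim (val y).

Definition covers (z y : attenuated) : bool :=
  (val y <= val z)%VS && (sdim z == (sdim y).+1).

Variable C : fieldType.

(* Mat_X(C): the poset X is enumerated by 'I_#|X| through enum_val. *)
Definition matX := 'M[C]_#|{: attenuated}|.

Definition mx_of_fun (f : attenuated -> attenuated -> C) : matX :=
  \matrix_(i, j) f (enum_val i) (enum_val j).

Definition raising : matX := mx_of_fun (fun y z => (covers y z)%:R).

Definition qlowering : matX :=
  mx_of_fun (fun y z => if covers z y then #|F|%:R ^+ sdim y else 0).

Definition Astar : matX :=
  mx_of_fun (fun y z => if y == z then #|F|%:R ^- sdim y else 0).

End AttenuatedSpace.

(* Main.v *)
(* In the first relation the entry at (y, z) reduces, when dim z = dim y + 1, to
   a count of pairs of coverings.  The elements c <> y covered by z that share an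
   upper cover with y are fibred over e = y :&: c: the fibre over e lies in the
   interval [e, z], which has q + 1 middle elements, and loses one of them, either
   y itself when y <= z, or the single c for which y + c meets h when y + z does.
   The remaining term comes from the number of covers of y in X dropping by
   q^(dim H - dim z) when y is replaced by z.
   The second cubic relation is the transpose of the first, since
   L^T = R D and R^T = D^-1 L for D = diag(q^(dim y)) = (A^* )^-1. *)
Require Import Defs.
From mathcomp Require Import all_boot all_order all_algebra finfield.
From mathcomp Require Import reals zify ring.
Import GRing.Theory.
Local Open Scope ring_scope.
Set Implicit Arguments.
Unset Strict Implicit.

(** * Counting subspaces *)
Section Subspaces.
Variables (F : finFieldType) (H : vectType F).
Implicit Types u w y z : {vspace H}.
Local Notation q := #|F|.
Local Open Scope nat_scope.

(* [covers z y] is convertible to [vcover (val z) (val y)]. *)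
Definition vcover z y := (y <= z)%VS && (\dim z == (\dim y).+1).

(** * Vectors and covers in the full lattice of subspaces *)

Lemma card_vectors w : #|[set v : finvect_type H | v \in w]| = q ^ \dim w.
Proof.
(* [{vspace H}] and [{vspace finvect_type H}] are convertible only for a
   constructor-headed [H]. *)
by case: H w => T c w; rewrite cardsE -(@card_vspace _ (finvect_type (Vector.Pack c))).
Qed.

Lemma card_vspaceD u w : (u <= w)%VS ->
  #|[set v : finvect_type H | (v \in w) && (v \notin u)]| = q ^ \dim w - q ^ \dim u.
Proof.
move=> suw; rewrite -!card_vectors -cardsDS.
  by apply: eq_card => v; rewrite !inE andbC.
by apply/subsetP => v; rewrite !inE; apply: (subvP suw).
Qed.

Lemma dim_add_line u (v : H) : v \notin u -> \dim (u + <[v]>) = (\dim u).+1.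
Proof.
move=> vu; have v0 : v != 0%R by apply: contraNneq vu => ->; rewrite mem0v.
rewrite dimv_disjoint_sum ?dim_vline ?v0 ?addn1 //.
apply/eqP; rewrite -subv0; apply/subvP => x /memv_capP[xu /vlineP[k xE]].
have [k0|k0] := eqVneq k 0%R; first by rewrite xE k0 scale0r mem0v.
by case/negP: vu; move: xu; rewrite xE rpredZeq (negPf k0).
Qed.

(** Each vector of [w] outside [u] generates with [u] a cover of [u] inside [w], and a cover [a]
    arises from exactly the vectors of [a] outside [u]. The multiplier stays on the left to avoid
    division in [nat]. *)
Lemma card_covers u w : (u <= w)%VS ->
  #|[set a | vcover a u && (a <= w)%VS]| * (q ^ (\dim u).+1 - q ^ \dim u)
  = q ^ \dim w - q ^ \dim u.
Proof.
move=> suw; rewrite -card_vspaceD // -[RHS]sum1_card.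
rewrite (partition_big (fun v : finvect_type H => u + <[v : H]>)%VS
          (mem [set a | vcover a u && (a <= w)%VS])) /=; last first.
  move=> v; rewrite !inE => /andP[vw vu].
  by rewrite /vcover addvSl dim_add_line // eqxx subv_add suw -memvE.
rewrite -sum_nat_const; apply: eq_bigr => a; rewrite inE => /andP[/andP[ua /eqP da] aw].
rewrite -da -card_vspaceD // -sum1_card; apply: eq_bigl => v; rewrite !inE.
apply/andP/andP => [[va vu]|[/andP[vw vu] /eqP<-]].
  rewrite (subvP aw) // vu; split=> //.
  by rewrite eqEdim subv_add ua -memvE va da (dim_add_line vu) ltnSn.
by rewrite vu; split => //; apply: (subvP (addvSr u _)); apply: memv_line.
Qed.

Let q_gt1 : 1 < q := finNzRing_gt1 F.

(** The quotient is a plane, which has (q^2 - 1) / (q - 1) lines. *)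
Lemma card_covers2 u w : (u <= w)%VS -> \dim w = (\dim u).+2 ->
  #|[set a | vcover a u && (a <= w)%VS]| = q.+1.
Proof.
move=> suw dw; have := card_covers suw; rewrite dw !expnS.
have : 0 < q ^ \dim u by rewrite expn_gt0 ltnW.
move: (q ^ _) #|[set _ | _]| q_gt1 => k x q1 k0 E.
have : x * (k * (q - 1)) = q.+1 * (k * (q - 1)) by nia.
by move/eqP; rewrite eqn_pmul2r; [move/eqP | nia].
Qed.

(** * Covers inside the attenuated space *)

Variable h : {vspace H}.
Local Notation X := (fun y : {vspace H} => (y :&: h == 0)%VS).

Lemma attenuatedS y z : (y <= z)%VS -> X z -> X y.
Proof. by move=> syz /eqP Xz; rewrite -subv0 -Xz capvS. Qed.

(** If [a] meets [h], then [y + a :&: h] is strictly larger than [y] and so fills [a]. Conversely,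
    if [a] misses [h], then [a + h] is too large to fit in [y + h]. *)
Lemma attenuated_covers y a : X y -> vcover a y -> X a = ~~ (a <= y + h)%VS.
Proof.
move=> /eqP Xy /andP[sya /eqP da]; apply/idP/idP => [/eqP Xa|].
  apply/negP => sa; have: (a + h <= y + h)%VS by rewrite subv_add sa addvSr.
  move/dimvS; rewrite !dimv_disjoint_sum // da; lia.
apply: contraR => Xa.
have d0: 0 < \dim (a :&: h) by rewrite lt0n dimv_eq0.
have: (y + a :&: h <= a)%VS by rewrite subv_add sya capvSl.
have dd: (y :&: (a :&: h) = 0)%VS.
  by apply/eqP; rewrite -subv0 -Xy capvS // capvSr.
move=> s; have /eqP <- : (y + a :&: h == a)%VS.
  by rewrite eqEdim s dimv_disjoint_sum // da; lia.
by rewrite addvS // capvSr.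
Qed.

(** The covers of [y] to discard are those inside [y + h], so two instances of [card_covers] are
    subtracted. *)
Lemma card_up y : X y ->
  #|[set a | vcover a y && X a]| * (q ^ (\dim y).+1 - q ^ \dim y)
  = q ^ \dim {:H} - q ^ (\dim y + \dim h).
Proof.
move=> Xy.
have -> : [set a | vcover a y && X a] =
  [set a | vcover a y && (a <= fullv)%VS] :\: [set a | vcover a y && (a <= y + h)%VS].
  apply/setP => a; rewrite !inE subvf andbT.
  case ca: (vcover a y) => //=.
  by rewrite (attenuated_covers Xy ca) andbT.
rewrite cardsDS; last first.
  by apply/subsetP => a; rewrite !inE subvf => /andP[->].
rewrite mulnBl !card_covers ?subvf ?addvSl // (dimv_disjoint_sum (eqP Xy)).
have : q ^ \dim y <= q ^ (\dim y + \dim h) by rewrite leq_exp2l // leq_addr.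
lia.
Qed.

(** With n the dimension of the whole space, [card_up] amounts to (q^(n - dim y) - q^(dim h)) / (q -
    1) covers, and only the first power changes from [y] to [z]. *)
Lemma card_upS y z : X y -> X z -> \dim z = (\dim y).+1 ->
  #|[set a | vcover a y && X a]|
  = #|[set a | vcover a z && X a]| + q ^ (\dim {:H} - \dim z).
Proof.
move=> Xy Xz dz; have := card_up Xy; have := card_up Xz.
have dzh : \dim z + \dim h <= \dim {:H}.
  by rewrite -dimv_disjoint_sum ?dimvS ?subvf //; apply/eqP.
have dH : \dim {:H} = (\dim {:H} - \dim z) + \dim z by rewrite subnK //; lia.
have le : q ^ (\dim z + \dim h) <= q ^ \dim {:H} by rewrite leq_exp2l.
have qH : q ^ \dim {:H} = q ^ (\dim {:H} - \dim z) * (q * q ^ \dim y).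
  by rewrite {1}dH expnD dz expnS.
move: le; rewrite qH dz addSn !expnS !expnD.
have : 0 < q ^ \dim y by rewrite expn_gt0 ltnW.
move: (q ^ (_ - _)) (q ^ \dim y) (q ^ \dim h) #|[set _ | _]| #|[set _ | _]| => r k m x x'.
move: #|F| q_gt1 => f q1 k0 le E1 E2.
(* One factor [f] is cancelled from the equation for [z], so that both counts carry the multiplier
   [f * k - k]. *)
have E3 : x' * (f * k - k) = r * k - k * m.
  apply/eqP; rewrite -(eqn_pmul2l (ltnW q1)); apply/eqP.
  by rewrite mulnCA mulnBr E1 mulnBr; congr (_ - _); lia.
have le' : k * m <= r * k by rewrite -(leq_pmul2l (ltnW q1)); lia.
apply/eqP; rewrite -(@eqn_pmul2r (f * k - k)); last by nia.
apply/eqP; rewrite E2 mulnDl E3 mulnBr.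
have : r * k <= r * (f * k) by rewrite leq_mul2l leq_pmull ?orbT // ltnW.
lia.
Qed.

(** * Common covers, and the fibration by [y :&: c] *)

Lemma subv_dim_eq u w : (u <= w)%VS -> \dim w <= \dim u -> u = w.
Proof. by move=> s d; apply/eqP; rewrite eqEdim s. Qed.

(** When [y] is not inside [z], every [y + c] lies in [y + z]. If [y + z] misses [h], none of the q
    + 1 middle elements is lost, whence the extra 1. *)
Lemma card_fiber y z e : X y -> X z -> \dim z = (\dim y).+1 ->
    vcover y e -> (e <= z)%VS ->
  #|[set c | [&& vcover c e, (c <= z)%VS, c != y & X (y + c)%VS]]|
  = q + (~~ (y <= z) && X (y + z))%VS.
Proof.
move=> Xy Xz dz /andP[sey /eqP dy] sez.
have cz := card_covers2 sez (etrans dz (congr1 S dy)).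
have [syz|nyz] /= := boolP (y <= z)%VS.
  apply/eqP; rewrite addn0 -eqSS -cz (cardsD1 y) inE /vcover sey dy eqxx syz.
  rewrite add1n eqSS; apply/eqP/eq_card => c; rewrite !inE.
  case: (c =P y) => [->|_]; rewrite ?andbF //=; congr (_ && _).
  case scz: (c <= z)%VS => //=.
  by rewrite (attenuatedS _ Xz) // subv_add syz scz.
have De : e = (y :&: z)%VS.
  apply: subv_dim_eq; first by rewrite subv_cap sey.
  rewrite -ltnS -dy ltn_neqAle dimvS ?capvSl // andbT.
  by apply: contra nyz => /eqP E; rewrite -(subv_dim_eq (capvSl y z)) ?E // capvSr.
have dyz : \dim (y + z) = (\dim y).+2 by have := dimv_sum_cap y z; rewrite -De; lia.
have meet_e c : vcover c e -> (c <= z)%VS -> (y :&: c = e)%VS.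
  move=> /andP[sec _] scz; apply/esym/subv_dim_eq; first by rewrite subv_cap sey.
  by rewrite De dimvS // capvS.
have dim_yc c : vcover c e -> (c <= z)%VS -> \dim (y + c) = (\dim y).+1.
  move=> cce scz; have := dimv_sum_cap y c; rewrite (meet_e c) //.
  by case/andP: cce => _ /eqP; lia.
have neq c : (c <= z)%VS -> c != y by apply: contraTneq => ->.
have [Xyz|nXyz] := boolP (X (y + z)%VS).
  rewrite addn1 -cz; apply: eq_card => c; rewrite !inE.
  case scz: (c <= z)%VS; rewrite ?andbF ?andbT //= neq //=.
  by rewrite (attenuatedS _ Xyz) ?andbT // addvS.
(* The trace of [h] on [y + z] is a line: it is nonzero, and it is disjoint from [z], which has
   codimension 1 in [y + z]. *)
pose l := ((y + z) :&: h)%VS.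
have disj x : X x -> (x :&: l = 0)%VS.
  by move=> /eqP Xx; apply/eqP; rewrite -subv0 -Xx capvS // capvSr.
have dl : \dim l = 1.
  have : 0 < \dim l by rewrite lt0n dimv_eq0.
  have : (z + l <= y + z)%VS by rewrite subv_add addvSr capvSl.
  move/dimvS; rewrite (dimv_disjoint_sum (disj _ Xz)) dyz; lia.
have dyl := dimv_disjoint_sum (disj _ Xy); rewrite dl addn1 in dyl.
(* This is the element to discard: [y + c0] turns out to be [y + l], which meets [h]. *)
pose c0 := ((y + l) :&: z)%VS.
have sc0z : (c0 <= z)%VS by rewrite capvSr.
have cc0 : vcover c0 e.
  rewrite /vcover subv_cap sez (subv_trans sey (addvSl _ _)) /=.
  have /(congr1 (fun x : {vspace H} => \dim x)): (y + l + z = y + z)%VS.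
    rewrite -addvA [(l + z)%VS]addvC addvA; apply/addv_idPl; exact: capvSl.
  by have := dimv_sum_cap (y + l) z; rewrite -/c0; lia.
apply/eqP; rewrite addn0 -eqSS -cz (cardsD1 c0 [set a | _]) inE cc0 sc0z.
rewrite add1n eqSS; apply/eqP/eq_card => c; rewrite !inE.
case cce: (vcover c e); rewrite ?andbF //=.
case scz: (c <= z)%VS; rewrite ?andbF ?andbT //= neq //=.
apply/idP/idP => [Xyc|].
  apply: contraTneq Xyc => ->.
  have -> : (y + c0 = y + l)%VS.
    apply: subv_dim_eq; first by rewrite subv_add addvSl capvSl.
    by rewrite dyl dim_yc.
  have sl : (l <= (y + l) :&: h)%VS by rewrite subv_cap addvSr capvSr.
  by rewrite -dimv_eq0 -lt0n -dl dimvS.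
(* If [y + c] meets [h], it does so in all of [l]; then [y + c] is [y + l], which forces [c] to be
   [c0]. *)
apply: contraR => nXyc; apply/eqP.
have dlc : 0 < \dim ((y + c) :&: h) by rewrite lt0n dimv_eq0.
have El : ((y + c) :&: h = l)%VS.
  by apply: subv_dim_eq; rewrite ?dl // capvS // addvS.
have Eyc : (y + l = y + c)%VS.
  by apply: subv_dim_eq; rewrite ?dyl ?dim_yc // subv_add addvSl -El capvSl.
apply: subv_dim_eq; first by rewrite /c0 Eyc subv_cap addvSr.
by case/andP: cce cc0 => _ /eqP -> /andP[_ /eqP ->].
Qed.

(** A common cover contains [y + c], which is already larger than [y], so [y + c] is the only
    candidate. *)
Lemma card_common_up y c : c != y -> \dim c = \dim y ->
  #|[set a | [&& vcover a y, vcover a c & X a]]|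
  = X (y + c)%VS && (\dim (y + c) == (\dim y).+1).
Proof.
move=> ncy dc.
have dlt : \dim y < \dim (y + c).
  rewrite ltn_neqAle dimvS ?addvSl // andbT.
  apply: contra ncy => /eqP d; have E := subv_dim_eq (addvSl y c) (eq_leq (esym d)).
  by apply/eqP/subv_dim_eq; rewrite ?dc // E addvSr.
have sup a : vcover a y -> vcover a c -> a = (y + c)%VS.
  move=> /andP[sya /eqP da] /andP[sca _]; apply/esym/subv_dim_eq.
    by rewrite subv_add sya.
  by rewrite da.
case: (boolP (_ && _)) => [/andP[Xyc dyc] | nXd]; last first.
  apply: eq_card0 => a; rewrite !inE; apply/negP => /and3P[ay ac Xa].
  by case/negP: nXd; rewrite -(sup a) // Xa; case/andP: ay.
apply: (etrans _ (cards1 (y + c)%VS)); apply: eq_card => a; rewrite !inE.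
apply/and3P/eqP => [[ay ac _]|->]; first exact: sup.
by split; rewrite // /vcover ?addvSl ?addvSr ?dc.
Qed.

(* Rewrites the condition that [c] lies in the fibre over [e] of [c |-> y :&: c]. *)
Lemma eq_fiber y z c e : \dim z = (\dim y).+1 -> vcover y e ->
  [&& vcover z c, c != y, X (y + c)%VS && (\dim (y + c) == (\dim y).+1)
    & (y :&: c == e)%VS]
  = [&& (e <= z)%VS, vcover c e, (c <= z)%VS, c != y & X (y + c)%VS].
Proof.
move=> dz /andP[sey /eqP dy].
case Xyc: (X (y + c)%VS); rewrite ?andbF //=.
have [//|ncy] := eqVneq c y; first by rewrite !andbF.
have dyc := dimv_sum_cap y c.
apply/idP/idP.
  case/and4P=> /andP[scz dc] _ /eqP dyc' /eqP ce.
  have sec : (e <= c)%VS by rewrite -ce capvSr.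
  rewrite (subv_trans sec scz) /vcover sec scz /= andbT.
  by apply/eqP; rewrite ce in dyc; move/eqP: dc; lia.
case/and4P=> sez /andP[sec /eqP dc] scz _.
have ce : e = (y :&: c)%VS.
  apply: subv_dim_eq; first by rewrite subv_cap sey.
  rewrite -ltnS -dy ltn_neqAle dimvS ?capvSl // andbT.
  apply: contra ncy => /eqP E; have E' := subv_dim_eq (capvSl y c) (eq_leq (esym E)).
  by apply/eqP/esym/subv_dim_eq; rewrite ?dc ?dy // -E' capvSr.
rewrite /vcover scz -ce eqxx /= andbT dz; rewrite -ce in dyc.
by apply/andP; split; apply/eqP; lia.
Qed.

(** The only candidates are [y + z] for [b] and [y :&: z] for [c]. By the dimension formula [y + z]
    covers [z] exactly when [y] covers [y :&: z], so the two counts differ only by the condition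
    that [y + z] misses [h]. *)
Lemma card_span y z : X y -> ~~ (y <= z)%VS -> \dim z = (\dim y).+1 ->
  #|[set b | [&& vcover b z, (y <= b)%VS & X b]]|
  = #|[set c | vcover y c && (c <= z)%VS]| * X (y + z)%VS.
Proof.
move=> Xy nyz dz; have dyz := dimv_sum_cap y z.
have dlt : \dim (y :&: z) < \dim y.
  rewrite ltn_neqAle dimvS ?capvSl // andbT.
  by apply: contra nyz => /eqP E; rewrite -(subv_dim_eq (capvSl y z)) ?E // capvSr.
have sup b : vcover b z -> (y <= b)%VS -> b = (y + z)%VS.
  move=> /andP[szb /eqP db] syb; apply/esym/subv_dim_eq.
    by rewrite subv_add syb.
  by rewrite db; lia.
have inf c : vcover y c -> (c <= z)%VS -> c = (y :&: z)%VS.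
  move=> /andP[scy /eqP dc] scz; apply/subv_dim_eq.
    by rewrite subv_cap scy.
  by lia.
have [dc|dc] := eqVneq (\dim y) (\dim (y :&: z)).+1.
  have -> : [set c | vcover y c && (c <= z)%VS] = [set (y :&: z)%VS].
    apply/setP => c; rewrite !inE; apply/andP/eqP => [[]|->]; first exact: inf.
    by rewrite capvSr /vcover capvSl dc eqxx.
  rewrite cards1 mul1n; case: (boolP (X _)) => Xyz.
    apply: (etrans _ (cards1 (y + z)%VS)); apply: eq_card => b; rewrite !inE.
    apply/and3P/eqP => [[] *|->]; first exact: sup.
    split; rewrite ?addvSl // /vcover addvSr /=; apply/eqP; lia.
  apply: eq_card0 => b; rewrite !inE; apply/negP => /and3P[bz yb].
  by rewrite (sup b) // (negPf Xyz).
rewrite [X in _ = X * _]eq_card0 => [|c]; last first.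
  rewrite !inE; apply/negP => /andP[yc cz]; case/negP: dc.
  by case/andP: (yc) => _ /eqP {1}->; rewrite (inf c).
rewrite mul0n; apply: eq_card0 => b; rewrite !inE; apply/negP => /and3P[bz yb _].
case/negP: dc; case/andP: (bz) => _; rewrite (sup b) // => /eqP; lia.
Qed.

(** Up to scalars, the left side is an entry of [L *m R *m L], and the terms on the right are
    entries of [L *m L *m R], [R *m L *m L] and [L]. The sum is split into [c = y], possible only
    when [y <= z], and [c != y]. *)
Lemma card_up_down y z : X y -> X z -> \dim z = (\dim y).+1 ->
  \sum_(c | vcover z c) #|[set a | [&& vcover a y, vcover a c & X a]]|
  = #|[set b | [&& vcover b z, (y <= b)%VS & X b]]|
    + q * #|[set c | vcover y c && (c <= z)%VS]|
    + (y <= z)%VS * q ^ (\dim {:H} - \dim z).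
Proof.
move=> Xy Xz dz; rewrite (bigID (pred1 y)) /=.
(* For [c != y] the summand is 0 or 1, and [Q c] says when it is 1; the sum becomes a cardinal that
   can be fibred. *)
pose Q c := X (y + c)%VS && (\dim (y + c) == (\dim y).+1).
have -> : \sum_(c | vcover z c && (c != y))
            #|[set a | [&& vcover a y, vcover a c & X a]]|
  = \sum_(c | [&& vcover z c, c != y & Q c]) 1.
  under [RHS]eq_bigl do rewrite andbA.
  rewrite [RHS]big_mkcondr; apply: eq_bigr => c /andP[/andP[_ dc] ncy].
  rewrite card_common_up //.
  by apply/eqP; rewrite -eqSS -dz eq_sym.
rewrite [X in _ + X](partition_big (fun c => y :&: c)%VS
           (mem [set e | vcover y e && (e <= z)%VS])) /=; last first.
  move=> c /and3P[/andP[scz /eqP dc] ncy /andP[_ /eqP dyc]].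
  rewrite inE /vcover capvSl (subv_trans (capvSr y c) scz) /= andbT.
  by have := dimv_sum_cap y c; lia.
have -> : \sum_(e in [set e | vcover y e && (e <= z)%VS])
    \sum_(c | [&& vcover z c, c != y & Q c] && (y :&: c == e)%VS) 1
  = #|[set e | vcover y e && (e <= z)%VS]| * (q + (~~ (y <= z) && X (y + z))%VS).
  rewrite -sum_nat_const; apply: eq_bigr => e; rewrite inE => /andP[ye sez].
  rewrite -(card_fiber Xy Xz dz ye sez) -sum1_card; apply: eq_bigl => c.
  by have := eq_fiber c dz ye; rewrite !inE sez /= => <-; rewrite /Q -!andbA.
have [syz|nyz] := boolP (y <= z)%VS.
  rewrite (big_pred1 y) => [|c]; last first.
    rewrite andbC /=; case: (c =P y) => [->|_] /=; last by [].
    by rewrite /vcover syz dz eqxx.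
  transitivity (#|[set a | vcover a y && X a]|
                + #|[set e | vcover y e && (e <= z)%VS]| * q).
    by rewrite addn0; congr (_ + _); apply: eq_card => a; rewrite !inE andbA andbb.
  rewrite (card_upS Xy Xz dz) mul1n [q * _]mulnC addnAC; congr (_ + _ + _).
  apply: eq_card => b; rewrite !inE; case zb: (vcover b z) => //=.
  by case/andP: zb => szb _; rewrite (subv_trans syz szb).
rewrite big_pred0 => [|c]; last first.
  by apply/negP => /andP[/andP[scz _] /eqP E]; case/negP: nyz; rewrite -E.
(* The extra 1 in each fibre, present when [y + z] misses [h], adds up to the count of [b] given by
   [card_span]. *)
by rewrite (card_span Xy nyz dz) add0n mul0n addn0 /= mulnDr addnC [q * _]mulnC.
Qed.

End Subspaces.

(** * Matrix relations *)
Section Matrices.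
Variables (F : finFieldType) (H : vectType F) (h : {vspace H}) (C : fieldType).
Implicit Types (f g : attenuated h -> attenuated h -> C) (y z : attenuated h).
Local Notation q := (#|F|%:R : C).
Local Notation R := (raising h C).
Local Notation L := (qlowering h C).
Local Notation A := (Astar h C).

(** * Calculus of matrices given by functions on the poset *)

Lemma mulmx_of_fun f g :
  mx_of_fun f *m mx_of_fun g = mx_of_fun (fun y z => \sum_x f y x * g x z).
Proof.
apply/matrixP => i j; rewrite !mxE [RHS](big_enum_val (A := {: attenuated h})).
by apply: eq_bigr => k _; rewrite !mxE.
Qed.

Lemma eq_mx_of_fun f g : (forall y z, f y z = g y z) -> mx_of_fun f = mx_of_fun g.
Proof. by move=> fg; apply/matrixP => i j; rewrite !mxE. Qed.

Lemma scale_mx_of_fun k f : k *: mx_of_fun f = mx_of_fun (fun y z => k * f y z).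
Proof. by apply/matrixP => i j; rewrite !mxE. Qed.

Lemma trmx_of_fun f : (mx_of_fun f)^T = mx_of_fun (fun y z => f z y).
Proof. by apply/matrixP => i j; rewrite !mxE. Qed.

Lemma mul_diag_mx_of_fun (d : attenuated h -> C) f :
  mx_of_fun (fun y z => if y == z then d y else 0) *m mx_of_fun f
  = mx_of_fun (fun y z => d y * f y z).
Proof.
rewrite mulmx_of_fun; apply: eq_mx_of_fun => y z.
rewrite (bigD1 y) //= eqxx big1 ?addr0 // => x xy.
by rewrite eq_sym (negPf xy) mul0r.
Qed.

Lemma mul_mx_of_fun_diag (d : attenuated h -> C) f :
  mx_of_fun f *m mx_of_fun (fun y z => if y == z then d y else 0)
  = mx_of_fun (fun y z => f y z * d z).
Proof.
rewrite mulmx_of_fun; apply: eq_mx_of_fun => y z.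
by rewrite (bigD1 z) //= eqxx big1 ?addr0 // => x /negPf->; rewrite mulr0.
Qed.

Lemma sum_attenuated (P : pred {vspace H}) :
  \sum_(x : attenuated h) (P (val x))%:R
  = #|[set v | P v && (v :&: h == 0)%VS]|%:R :> C.
Proof.
rewrite -natr_sum; congr (_%:R); rewrite -sum1_card.
rewrite (eq_bigl (fun v => (v :&: h == 0)%VS && P v)) => [|v]; last first.
  by rewrite inE andbC.
rewrite big_mkcondr (big_sub [pred v | (v :&: h == 0)%VS]) /=.
by apply: eq_bigr => x _; case: (P _).
Qed.

(** * Entries of the cubic products *)

(** The q + 1 middle elements of the interval all miss [h] because [z] does, and the weights along a
    chain multiply to q^(dim y) q^(dim y + 1). *)
Lemma qlowering_sq : L *m L = mx_of_fun (fun y z =>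
  ((val y <= val z)%VS && (sdim z == (sdim y).+2))%:R * ((q + 1) * q ^+ (sdim y).*2.+1)).
Proof.
rewrite mulmx_of_fun; apply: eq_mx_of_fun => y z.
transitivity (\sum_(x : attenuated h)
    (vcover (val x) (val y) && vcover (val z) (val x))%:R * q ^+ (sdim y).*2.+1).
  apply: eq_bigr => x _.
  rewrite -[vcover _ (val y)]/(covers x y) -[vcover _ _]/(covers z x).
  case: (boolP (covers x y)) => [/andP[_ /eqP dx]|_] /=; last by rewrite !mul0r.
  case: ifP => _; last by rewrite mul0r mulr0.
  by rewrite dx mul1r -exprD addnS addnn.
rewrite -mulr_suml mulrA; congr (_ * _).
rewrite (sum_attenuated (fun x => vcover x (val y) && vcover (val z) x)).
have [/andP[syz /eqP dz]|nyz] := boolP (_ && _).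
  rewrite mul1r natr1 -(card_covers2 syz dz).
  congr (_%:R); apply: eq_card => x; rewrite !inE.
  case xy: (vcover x (val y)) => //=; case/andP: xy => _ /eqP dx.
  rewrite /vcover dx -/(sdim z) dz eqxx andbT.
  by case sxz: (_ <= _)%VS; rewrite //= (attenuatedS sxz (valP z)).
rewrite mul0r eq_card0 // => x; rewrite !inE; apply/negP.
move=> /andP[/andP[/andP[syx /eqP dx] /andP[sxz /eqP dz]] _].
by case/negP: nyz; rewrite (subv_trans syx sxz) /sdim dz dx eqxx.
Qed.

Local Notation n := (\dim {:H}).

Lemma qlowering_sq_raising : L *m L *m R = mx_of_fun (fun y z =>
  if sdim z == (sdim y).+1 then
    (q + 1) * q ^+ (sdim y).*2.+1 *
    #|[set b | [&& vcover b (val z), (val y <= b)%VS & (b :&: h == 0)%VS]]|%:R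
  else 0).
Proof.
rewrite qlowering_sq mulmx_of_fun; apply: eq_mx_of_fun => y z.
case: eqP => [dz|ndz]; last first.
  rewrite big1 // => b _; case: andP => [[_ /eqP db]|_]; last by rewrite !mul0r.
  case: (boolP (covers b z)) => [/andP[_ /eqP db']|_]; last by rewrite mulr0.
  by case: ndz; move: db'; rewrite db => -[].
rewrite -(eq_card (A := [set b | (vcover b (val z) && (val y <= b)%VS)
                                 && (b :&: h == 0)%VS])) => [|b]; last first.
  by rewrite !inE andbA.
rewrite -(sum_attenuated (fun b => vcover b (val z) && (val y <= b)%VS)).
rewrite mulr_sumr; apply: eq_bigr => b _.
rewrite -[vcover _ _]/(covers b z).
case: (boolP (covers b z)) => [/andP[_ /eqP db]|_]; last by rewrite !mulr0.
by rewrite db dz eqxx andbT mulr1 mulrC.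
Qed.

(** Here [L *m L] starts at some [c] of dimension one less than [y]. The factor q^2 makes up for
    this, giving the same weight as in [qlowering_sq_raising] without a predecessor in the
    exponent. *)
Lemma raising_qlowering_sq : q ^+ 2 *: (R *m L *m L) = mx_of_fun (fun y z =>
  if sdim z == (sdim y).+1 then
    (q + 1) * q ^+ (sdim y).*2.+1 *
    #|[set c | vcover (val y) c && (c <= val z)%VS]|%:R
  else 0).
Proof.
rewrite -mulmxA qlowering_sq mulmx_of_fun scale_mx_of_fun.
apply: eq_mx_of_fun => y z; rewrite mulr_sumr.
case: eqP => [dz|ndz]; last first.
  rewrite big1 // => c _; case: (boolP (covers y c)) => [/andP[_ /eqP dy]|_].
    by rewrite -dy; case: andP => [[_ /eqP]|_]; rewrite ?mul0r ?mulr0.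
  by rewrite mul0r mulr0.
rewrite -(eq_card (A := [set c | (vcover (val y) c && (c <= val z)%VS)
                                 && (c :&: h == 0)%VS])) => [|c]; last first.
  rewrite !inE; case scy: (vcover _ c) => //=.
  by case/andP: scy => scy _; rewrite (attenuatedS scy (valP y)) andbT.
rewrite -(sum_attenuated (fun c => vcover (val y) c && (c <= val z)%VS)).
rewrite mulr_sumr; apply: eq_bigr => c _.
rewrite -[vcover _ _]/(covers y c).
case: (boolP (covers y c)) => [/andP[_ /eqP dy]|_]; last by rewrite mul0r !mulr0.
by rewrite dz dy eqxx andbT doubleS !exprS /=; ring.
Qed.

(** The two lowering weights are q^(dim y) and q^(dim c), and a common cover forces these dimensions
    to agree. The sum may run over all subspaces [c], since [c <= z] puts [c] in the poset. *)
Lemma qlowering_raising_qlowering : L *m R *m L = mx_of_fun (fun y z =>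
  if sdim z == (sdim y).+1 then
    q ^+ (sdim y).*2 *
    (\sum_(c | vcover (val z) c)
       #|[set a | [&& vcover a (val y), vcover a c & (a :&: h == 0)%VS]]|)%N%:R
  else 0).
Proof.
rewrite mulmx_of_fun mulmx_of_fun; apply: eq_mx_of_fun => y z.
pose w (c : {vspace H}) :=
  #|[set a | [&& vcover a (val y), vcover a c & (a :&: h == 0)%VS]]|.
transitivity (\sum_(c : attenuated h) q ^+ sdim y * (w (val c))%:R
    * if covers z c then q ^+ sdim c else 0).
  apply: eq_bigr => c _; congr (_ * _).
  rewrite /w -(eq_card (A := [set a | (vcover a (val y) && vcover a (val c))
                                 && (a :&: h == 0)%VS])) => [|a]; last first.
    by rewrite !inE andbA.
  rewrite -(sum_attenuated (fun a => vcover a (val y) && vcover a (val c))).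
  rewrite mulr_sumr; apply: eq_bigr => a _.
  rewrite -[vcover _ (val y)]/(covers a y) -[vcover _ _]/(covers a c).
  by case: (covers a y) => /=; rewrite ?mul0r ?mulr0.
case: eqP => [dz|ndz]; last first.
  rewrite big1 // => c _.
  case: (boolP (covers z c)) => [/andP[_ /eqP dc]|_]; last by rewrite mulr0.
  rewrite /w eq_card0 ?mulr0 ?mul0r // => a; rewrite !inE; apply/negP.
  move=> /and3P[/andP[_ /eqP da] /andP[_ /eqP]]; rewrite da => -[dyc] _.
  by case: ndz; rewrite dc /sdim dyc.
rewrite natr_sum mulr_sumr.
transitivity (\sum_(c | (c :&: h == 0)%VS && vcover (val z) c)
   q ^+ (sdim y).*2 * (w c)%:R); last first.
  apply: eq_bigl => c; case zc: (vcover _ c); rewrite ?andbF // andbT.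
  by case/andP: zc => scz _; rewrite (attenuatedS scz (valP z)).
rewrite big_mkcondr (big_sub [pred v | (v :&: h == 0)%VS]) /=.
apply: eq_bigr => c _; rewrite -[vcover _ _]/(covers z c).
case: (boolP (covers z c)) => [/andP[_ /eqP dc]|_]; last by rewrite mulr0.
by rewrite -addnn exprD; move: dc; rewrite dz => -[->]; ring.
Qed.

(** The relation is [card_up_down] multiplied by (q + 1) q^(2 dim y + 1). When dim z = dim y + 1,
    the power q^(n - dim z) becomes q^n times the weight q^(dim y) of [L]. *)
Lemma qlowering_relation :
  L *m L *m R - (q * (q + 1)) *: (L *m R *m L) + q ^+ 3 *: (R *m L *m L)
  = - (q ^+ n * (q + 1)) *: L.
Proof.
rewrite [q ^+ 3]exprS -[(q * q ^+ 2) *: _]scalerA raising_qlowering_sq.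
rewrite qlowering_sq_raising qlowering_raising_qlowering.
apply/matrixP => i j; rewrite !mxE.
move: (enum_val i) (enum_val j) => y z.
case: eqP => [dz|ndz]; last first.
  case: (boolP (covers z y)) => [/andP[_ /eqP//]|_]; by rewrite !mulr0 subr0 addr0.
rewrite (card_up_down (valP y) (valP z) dz).
have -> : covers z y = (val y <= val z)%VS by rewrite /covers dz eqxx andbT.
have dzn : n = ((n - sdim z) + (sdim y).+1)%N by rewrite -dz subnK // dimvS ?subvf.
rewrite !natrD !natrM natrX -/(sdim z).
have -> : q ^+ n = q ^+ (n - sdim z) * (q * q ^+ sdim y) by rewrite {1}dzn exprD exprS.
by case: (_ <= _)%VS; rewrite /= !exprS -addnn !exprD; ring.
Qed.

(** * Diagonal weights and transposition *)

Lemma raising_Astar : q != 0 -> R *m A = q *: (A *m R).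
Proof.
move=> q0; rewrite mul_mx_of_fun_diag mul_diag_mx_of_fun scale_mx_of_fun.
apply: eq_mx_of_fun => y z.
case: (boolP (covers y z)) => [/andP[_ /eqP->]|_]; last by rewrite mul0r !mulr0.
by rewrite mulr1 mul1r exprS invfM mulVKf.
Qed.

Lemma qlowering_Astar : q != 0 -> L *m A = q^-1 *: (A *m L).
Proof.
move=> q0; rewrite mul_mx_of_fun_diag mul_diag_mx_of_fun scale_mx_of_fun.
apply: eq_mx_of_fun => y z.
case: (boolP (covers z y)) => [/andP[_ /eqP->]|_]; last by rewrite mul0r !mulr0.
by rewrite mulVf ?expf_neq0 // mulr1 exprS invfM mulrCA divff ?expf_neq0 // mulr1.
Qed.

Lemma trmx_raising : q != 0 -> R^T = A *m L.
Proof.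
move=> q0; rewrite trmx_of_fun mul_diag_mx_of_fun; apply: eq_mx_of_fun => y z.
by case: (covers z y); rewrite ?mulr0 // mulVf ?expf_neq0.
Qed.

Let D : matX h C := mx_of_fun (fun y z => if y == z then q ^+ sdim y else 0).

Lemma trmx_qlowering : L^T = R *m D.
Proof.
rewrite trmx_of_fun mul_mx_of_fun_diag; apply: eq_mx_of_fun => y z.
by case: (covers y z); rewrite ?mul0r ?mul1r.
Qed.

Lemma mul_weight_Astar : q != 0 -> D *m A = 1%:M.
Proof.
move=> q0; rewrite mul_diag_mx_of_fun; apply/matrixP => i j; rewrite !mxE.
rewrite (inj_eq enum_val_inj); case: eqP => [->|_]; last by rewrite mulr0.
by rewrite divff ?expf_neq0.
Qed.

Lemma weight_raising : D *m R = q *: (R *m D).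
Proof.
rewrite mul_mx_of_fun_diag mul_diag_mx_of_fun scale_mx_of_fun.
apply: eq_mx_of_fun => y z.
case: (boolP (covers y z)) => [/andP[_ /eqP->]|_]; last by rewrite mul0r !mulr0.
by rewrite mulr1 mul1r exprS.
Qed.

Lemma weight_qlowering : q *: (D *m L) = L *m D.
Proof.
rewrite mul_mx_of_fun_diag mul_diag_mx_of_fun scale_mx_of_fun.
apply: eq_mx_of_fun => y z.
case: (boolP (covers z y)) => [/andP[_ /eqP->]|_]; last by rewrite mul0r !mulr0.
by rewrite exprS; ring.
Qed.

(** Transposing reverses each product and swaps [R] and [L] up to diagonal factors. Moving these to
    the right leaves one [D] in every term, which [A] then cancels. *)
Lemma raising_relation : q != 0 ->
  L *m R *m R - (q * (q + 1)) *: (R *m L *m R) + q ^+ 3 *: (R *m R *m L)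
  = - (q ^+ n * (q + 1)) *: R.
Proof.
move=> q0; have DA := mul_weight_Astar q0; have AD := mulmx1C DA.
have AL : A *m L = q *: (L *m A).
  by rewrite qlowering_Astar // scalerA divff // scale1r.
have AR : q *: (A *m R) = R *m A by rewrite raising_Astar.
have DR := weight_raising; have DL := weight_qlowering.
(* [L] and [R] shift the weight in opposite directions, so [A] commutes with [L *m R]. *)
have ALR : A *m L *m R = L *m R *m A.
  by rewrite AL -scalemxAl -mulmxA scalemxAr AR mulmxA.
have E1 : (L *m L *m R)^T = L *m R *m R *m D.
  rewrite !trmx_mul trmx_raising // trmx_qlowering !mulmxA ALR.
  by rewrite -[_ *m A *m D]mulmxA AD mulmx1.
have E2 : (L *m R *m L)^T = R *m L *m R *m D.
  rewrite !trmx_mul trmx_raising // trmx_qlowering !mulmxA.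
  by rewrite -[_ *m D *m A]mulmxA DA mulmx1.
(* Moving [D] past [R] produces a factor q, which moving it past [L] absorbs. *)
have E3 : (R *m L *m L)^T = R *m R *m L *m D.
  rewrite !trmx_mul trmx_raising // trmx_qlowering !mulmxA.
  rewrite -[_ *m D *m A]mulmxA DA mulmx1 -[_ *m D *m R]mulmxA DR.
  by rewrite -scalemxAr -scalemxAl mulmxA -[_ *m D *m L]mulmxA scalemxAr DL !mulmxA.
have := congr1 (fun M => M^T *m A) qlowering_relation.
rewrite [(_ + _)^T]raddfD /= [(_ - _)^T]raddfB /= ![(_ *: _)^T]linearZ /=.
rewrite E1 E2 E3 trmx_qlowering mulmxDl mulmxBl -!scalemxAl.
by rewrite -![_ *m D *m A]mulmxA DA !mulmx1.
Qed.

End Matrices.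

Theorem proposition7p8 (K : realType) (F : finFieldType) (N M : nat)
    (H : vectType F) (h : {vspace H})
    (N_gt0 : (0 < N)%N) (M_gt0 : (0 < M)%N)
    (dimH : \dim {:H} = (N + M)%N) (dimh : \dim h = M) :
  let q : K[i]%C := #|F|%:R in
  let R := raising h K[i]%C in
  let L := qlowering h K[i]%C in
  let A := Astar h K[i]%C in
  [/\ R *m A = q *: (A *m R),
      L *m A = q^-1 *: (A *m L),
      L *m L *m R - (q * (q + 1)) *: (L *m R *m L) + q ^+ 3 *: (R *m L *m L)
        = - (q ^+ (N + M) * (q + 1)) *: L
    & L *m R *m R - (q * (q + 1)) *: (R *m L *m R) + q ^+ 3 *: (R *m R *m L)
        = - (q ^+ (N + M) * (q + 1)) *: R].
Proof.
move=> q R L A; rewrite -dimH.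
(* The field [K[i]] has characteristic zero, so the positive integer [#|F|] stays nonzero there. *)
have q0 : q != 0 by rewrite Num.Theory.pnatr_eq0 -lt0n ltnW ?finNzRing_gt1.
split; [exact: raising_Astar | exact: qlowering_Astar |
        exact: qlowering_relation | exact: raising_relation].
Qed.
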